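(* Let $(a_n)_{n\ge 1}$ be the real sequence defined by $a_1=1$ and $$a_{n+1}=a_n+\frac{1}{a_n},\qquad n\ge 1.$$ Then $a_n\sim\sqrt{2n}$ as $n\to\infty$, that is, $\lim_{n\to\infty}\dfrac{a_n}{\sqrt{2n}}=1$. *)

(* Defs.v *)
From Stdlib Require Import Reals.
From Coquelicot Require Import Coquelicot.

(* Main.v *)
(** The squares satisfy [a_(n+1)^2 = a_n^2 + 2 + 1 / a_n^2].  Hence
    [a_n^2 >= 2 n - 1], so the increments [1 / a_n^2] are at most
    [1 / (2 n - 1)] and their sum is [O(sqrt n)]; this crude bound suffices
    for [a_n^2 / (2 n) -> 1]. *)
Require Import Defs.
From Stdlib Require Import Reals Lra.
From Coquelicot Require Import Coquelicot.
Open Scope R_scope.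

Lemma one_le_sqrt (x : R) : 1 <= x -> 1 <= sqrt x.
Proof. intros Hx; rewrite <- sqrt_1; apply sqrt_le_1_alt; exact Hx. Qed.

(** Rationalising turns the increment into [/ (sqrt (x + 1) + sqrt x)]. Since [sqrt y <= y] for
    [1 <= y], that denominator is at most [2 * x + 1], which is below [4 * (2 * x - 1)]. The
    right-hand side is chosen to telescope when summed. *)
Lemma recip_le_sqrt_increment (x : R) :
  1 <= x -> / (2 * x - 1) <= 4 * (sqrt (x + 1) - sqrt x).
Proof.
  intros Hx.
  assert (H1 : sqrt x * sqrt x = x) by (apply sqrt_sqrt; lra).
  assert (H2 : sqrt (x + 1) * sqrt (x + 1) = x + 1) by (apply sqrt_sqrt; lra).
  assert (P1 : 1 <= sqrt x) by (apply one_le_sqrt; lra).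
  assert (P2 : 1 <= sqrt (x + 1)) by (apply one_le_sqrt; lra).
  assert (L1 : sqrt x <= x) by nra.
  assert (L2 : sqrt (x + 1) <= x + 1) by nra.
  replace (sqrt (x + 1) - sqrt x) with (/ (sqrt (x + 1) + sqrt x)).
  - replace (4 * / (sqrt (x + 1) + sqrt x))
      with (/ ((sqrt (x + 1) + sqrt x) / 4)) by (field; lra).
    apply Rinv_le_contravar; lra.
  - apply Rmult_eq_reg_l with (sqrt (x + 1) + sqrt x); [| lra].
    rewrite Rinv_r by lra. nra.
Qed.

Lemma sqr_add_inv (x : R) :
  x <> 0 -> (x + 1 / x) * (x + 1 / x) = x * x + 2 + / (x * x).
Proof. intros Hx; field; exact Hx. Qed.

(** One induction carries all three facts: positivity makes the division legitimate, and the lower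
    bound controls the increment [/ (a n * a n)] in the upper one. The term [4 * sqrt (INR n)]
    absorbs the telescoped increments. *)
Lemma rec_pos_sqr_bounds (a : nat -> R)
  (ha1 : a 1%nat = 1)
  (harec : forall n : nat, (1 <= n)%nat -> a (S n) = a n + 1 / a n)
  (n : nat) :
  (1 <= n)%nat ->
  0 < a n /\ 2 * INR n - 1 <= a n * a n <= 2 * INR n + 4 * sqrt (INR n).
Proof.
  intros Hn; induction Hn as [| n Hn [Hpos [Hlo Hup]]].
  - rewrite ha1; simpl INR; rewrite sqrt_1; lra.
  - assert (Hn1 : 1 <= INR n) by (apply (le_INR 1); exact Hn).
    rewrite harec by exact Hn.
    assert (Hd : 0 < 1 / a n) by (apply Rdiv_lt_0_compat; lra).
    rewrite sqr_add_inv by lra.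
    rewrite S_INR.
    assert (Hi : / (a n * a n) <= / (2 * INR n - 1))
      by (apply Rinv_le_contravar; lra).
    assert (Hi0 : 0 < / (a n * a n)) by (apply Rinv_0_lt_compat; nra).
    pose proof (recip_le_sqrt_increment (INR n) Hn1).
    repeat split; lra.
Qed.

Lemma rec_ratio_dist (a : nat -> R)
  (ha1 : a 1%nat = 1)
  (harec : forall n : nat, (1 <= n)%nat -> a (S n) = a n + 1 / a n)
  (n : nat) :
  (1 <= n)%nat ->
  Rabs (a n / sqrt (2 * INR n) - 1) <= 2 * / sqrt (INR n).
Proof.
  intros Hn.
  destruct (rec_pos_sqr_bounds a ha1 harec n Hn) as [Hpos [Hlo Hup]].
  assert (Hn1 : 1 <= INR n) by (apply (le_INR 1); exact Hn).
  assert (Hr : 1 <= sqrt (INR n)) by (apply one_le_sqrt; lra).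
  assert (Hrr : sqrt (INR n) * sqrt (INR n) = INR n) by (apply sqrt_sqrt; lra).
  assert (Hs : 0 < sqrt (2 * INR n)) by (apply sqrt_lt_R0; lra).
  assert (Hss : sqrt (2 * INR n) * sqrt (2 * INR n) = 2 * INR n)
    by (apply sqrt_sqrt; lra).
  set (q := a n / sqrt (2 * INR n)).
  assert (Hq : 0 < q) by (apply Rdiv_lt_0_compat; lra).
  assert (Hqq : q * q * (2 * INR n) = a n * a n)
    by (rewrite <- Hss at 1; unfold q; field; lra).
  (* This is the error [4 * sqrt (INR n)] of the upper bound divided by [2 * INR n]. *)
  set (e := 2 * / sqrt (INR n)).
  assert (He : 0 < e)
    by (apply Rmult_lt_0_compat; [lra | apply Rinv_0_lt_compat; lra]).
  assert (Hen : e * (2 * INR n) = 4 * sqrt (INR n))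
    by (rewrite <- Hrr at 1; unfold e; field; lra).
  assert (Hq1 : q * q <= 1 + e)
    by (apply Rmult_le_reg_r with (2 * INR n); lra).
  (* The lower bound misses [2 * INR n] only by 1, which is at most [4 * sqrt (INR n)], so the same
     [e] serves on both sides. *)
  assert (Hq2 : 1 - e <= q * q)
    by (apply Rmult_le_reg_r with (2 * INR n); lra).
  (* [|q - 1| <= |q^2 - 1|] because [q > 0]. *)
  apply Rabs_le; split; nra.
Qed.

Theorem mainTheorem1 (a : nat -> R)
  (ha1 : a 1%nat = 1)
  (harec : forall n : nat, (1 <= n)%nat -> a (S n) = a n + 1 / a n) :
  is_lim_seq (fun n : nat => a n / sqrt (2 * INR n)) (Finite 1).
Proof.
  assert (He : is_lim_seq (fun n => 2 * / sqrt (INR n)) 0).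
  { replace (Finite 0) with (Rbar_mult 2 0) by (simpl; f_equal; ring).
    apply is_lim_seq_scal_l.
    apply (is_lim_seq_inv _ p_infty); [| discriminate].
    apply (filterlim_comp _ _ _ INR sqrt _ (Rbar_locally p_infty)).
    - exact is_lim_seq_INR.
    - exact filterlim_sqrt_p. }
  (* The squeeze holds only from index 1 on: [a 0] is unconstrained and the ratio there divides by
     [sqrt 0]. *)
  apply is_lim_seq_le_le_loc
    with (u := fun n => 1 - 2 * / sqrt (INR n))
         (w := fun n => 1 + 2 * / sqrt (INR n)).
  - exists 1%nat; intros n Hn.
    pose proof (rec_ratio_dist a ha1 harec n Hn) as H.
    apply Rabs_le_between in H; lra.
  - replace 1 with (1 - 0) at 1 by ring.
    apply is_lim_seq_minus'; [apply is_lim_seq_const | exact He].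
  - replace 1 with (1 + 0) at 1 by ring.
    apply is_lim_seq_plus'; [apply is_lim_seq_const | exact He].
Qed.
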